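(* Let $F$ be a field of characteristic $\neq2$, let $\mathfrak g$ be a Lie algebra over $F$ endowed with a group homomorphism $S_4\to\mathrm{Aut}(\mathfrak g)$, and let $A=\mathfrak g_0$, the map $x\mapsto\bar x$, the multiplication $\cdot$ on $A$, and the maps $\delta_0,\delta_1,\delta_2:A\times A\to\mathfrak{gl}(A)$ be as defined in the context. Then for any $a,b,x,y,z\in A$ and $i,j\in\mathbb Z_3$: (i) $[\delta_i(a,b),\delta_j(x,y)]=\delta_j\bigl(\delta_{i-j}(a,b)(x),y\bigr)+\delta_j\bigl(x,\delta_{i-j}(a,b)(y)\bigr)$; (ii) $\delta_0(\bar x,y\cdot z)+\delta_1(\bar y,z\cdot x)+\delta_2(\bar z,x\cdot y)=0$; (iii) $\delta_0(x,y)(z)+\delta_0(y,z)(x)+\delta_0(z,x)(y)=0$; (iv) $\delta_1(x,y)=L_{\bar y}L_x-L_{\bar x}L_y$; (v) $\delta_2(x,y)=R_{\bar y}R_x-R_{\bar x}R_y$; (vi) $\overline{\delta_i(x,y)}=\delta_{-i}(\bar x,\bar y)$ (equivalently, $\xi(\delta(x,y))=\delta(\bar x,\bar y)$, where $\delta=(\delta_0,\delta_1,\delta_2)$), where $L_x:z\mapsto x\cdot z$ and $R_x:z\mapsto z\cdot x$.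
   Context: In $S_4$ put $\tau_1=(12)(34)$, $\tau_2=(23)(14)$, $\varphi=(123)$ (i.e. $1\mapsto2\mapsto3\mapsto1$), $\tau=(12)$, with permutations composed right to left, so that $\varphi\tau_1=\tau_2\varphi$, $\varphi\tau_2=\tau_1\tau_2\varphi$, $\tau_1\tau=\tau\tau_1$, $\tau_2\tau=\tau\tau_2\tau_1$, $\tau\varphi=\varphi^2\tau$. Their images in $\mathrm{Aut}(\mathfrak g)$ are denoted by the same symbols. Define $\mathfrak t=\{x\in\mathfrak g:\tau_1(x)=x,\ \tau_2(x)=x\}$, $\mathfrak g_0=\{x:\tau_1(x)=x,\ \tau_2(x)=-x\}$, $\mathfrak g_1=\{x:\tau_1(x)=-x,\ \tau_2(x)=x\}$, $\mathfrak g_2=\{x:\tau_1(x)=-x,\ \tau_2(x)=-x\}$ (indices in $\mathbb Z_3$). Then $\mathfrak g=\mathfrak t\oplus\mathfrak g_0\oplus\mathfrak g_1\oplus\mathfrak g_2$ is a $\mathbb Z_2\times\mathbb Z_2$-grading, $\varphi(\mathfrak t)=\mathfrak t$, $\varphi(\mathfrak g_i)=\mathfrak g_{i+1}$ and $\tau(\mathfrak g_0)=\mathfrak g_0$. Put $A=\mathfrak g_0$ and, for $x\in A$, $\iota_0(x)=x$, $\iota_1(x)=\varphi(x)$, $\iota_2(x)=\varphi^2(x)$. A bilinear multiplication $*$ on $A$ is defined by $[\iota_1(x),\iota_2(y)]=\iota_0(x*y)$ (equivalently $[\iota_i(x),\iota_{i+1}(y)]=\iota_{i+2}(x*y)$ for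 all $i\in\mathbb Z_3$). The linear map $x\mapsto\bar x$ on $A$ is defined by $\tau(\iota_0(x))=-\iota_0(\bar x)$; it is an involution of $(A,* )$. A new multiplication on $A$ is defined by $x\cdot y=\overline{x*y}=\bar y*\bar x$. For $i\in\mathbb Z_3$ define $\rho_i:\mathfrak t\to\mathfrak{gl}(A)$ by $\iota_i(\rho_i(d)(x))=[d,\iota_i(x)]$, and put $\delta_i(x,y)=\rho_i([\iota_0(x),\iota_0(y)])$ for $x,y\in A$. Here $\mathfrak{gl}(A)$ is the Lie algebra of linear endomorphisms of $A$. For $d\in\mathfrak{gl}(A)$, $\bar d\in\mathfrak{gl}(A)$ is given by $\bar d(x)=\overline{d(\bar x)}$, and $\xi(d_0,d_1,d_2)=(\bar d_0,\bar d_2,\bar d_1)$. *)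

(* Defs.v *)
From HB Require Import structures.
From mathcomp Require Import all_boot all_order all_algebra all_fingroup.

Set Implicit Arguments.
Unset Strict Implicit.
Unset Printing Implicit Defensive.

Import GRing.Theory.
Local Open Scope ring_scope.

HB.mixin Record Lmodule_isLieAlgebra (F : fieldType) g of GRing.Lmodule F g := {
  lie : g -> g -> g;
  lie_bilinear : bilinear_for *:%R *:%R lie;
  liexx : forall x, lie x x = 0;
  lie_jacobi : forall x y z,
    lie x (lie y z) + lie y (lie z x) + lie z (lie x y) = 0
}.

#[short(type="lieAlgType")]
HB.structure Definition LieAlgebra (F : fieldType) :=
  {g of GRing.Lmodule F g & Lmodule_isLieAlgebra F g}.

Notation "[lie x , y ]" := (lie x y)
  (at level 0, x, y at level 99, format "[lie  x ,  y ]") : ring_scope.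

HB.instance Definition _ (F : fieldType) (g : lieAlgType F) :=
  bilinear_isBilinear.Build F g g g _ _ (@lie F g) lie_bilinear.

Lemma lie_anti (F : fieldType) (g : lieAlgType F) (x y : g) :
  [lie x, y] = - [lie y, x].
Proof.
apply/eqP; rewrite -addr_eq0; apply/eqP.
have := liexx (x + y).
by rewrite linearDl /= !linearDr /= !liexx add0r addr0.
Qed.

Record lie_aut (F : fieldType) (g : lieAlgType F) := LieAut {
  lie_aut_fun :> {linear g -> g};
  lie_aut_lie : forall x y,
    lie_aut_fun [lie x, y] = [lie lie_aut_fun x, lie_aut_fun y];
  lie_aut_bij : bijective lie_aut_fun
}.

(* Permutations here compose right to left, i.e. s o t means "t first".  In
   MathComp s * t means "s first", so s o t is written t * s and a homomorphism
   into Aut(g), composed as functions, sends s * t to act t \o act s. *)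
Record s4_action (F : fieldType) (g : lieAlgType F) := S4Action {
  s4_act :> 'S_4 -> lie_aut g;
  s4_actM : forall s t : 'S_4, s4_act (s * t)%g =1 s4_act t \o s4_act s
}.

(* The point k of {1, 2, 3, 4}, represented in 'I_4 = {0, 1, 2, 3}. *)
Definition pt (k : nat) : 'I_4 := inord k.-1.

Definition tau1 : 'S_4 := (tperm (pt 1) (pt 2) * tperm (pt 3) (pt 4))%g.
Definition tau2 : 'S_4 := (tperm (pt 2) (pt 3) * tperm (pt 1) (pt 4))%g.
(* The 3-cycle 1 |-> 2 |-> 3 |-> 1; see phi_pt. *)
Definition phi : 'S_4 := (tperm (pt 1) (pt 2) * tperm (pt 1) (pt 3))%g.
Definition tau : 'S_4 := tperm (pt 1) (pt 2).

Lemma pt_inj i j : (0 < i <= 4)%N -> (0 < j <= 4)%N -> (pt i == pt j) = (i == j).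
Proof.
by case: i j => [//|i] [//|j] /= ? ?; rewrite -val_eqE /= !inordK.
Qed.

Lemma ptP (P : 'I_4 -> Prop) : P (pt 1) -> P (pt 2) -> P (pt 3) -> P (pt 4) ->
  forall i, P i.
Proof.
move=> P1 P2 P3 P4 i; have -> : i = pt i.+1 by rewrite /pt inord_val.
by case: i => [[|[|[|[|//]]]] ?].
Qed.

Lemma tperm_if (x y z : 'I_4) :
  tperm x y z = if z == x then y else if z == y then x else z.
Proof.
case: tpermP => [->|->|/eqP/negPf-> /eqP/negPf-> //]; first by rewrite eqxx.
by rewrite eqxx; case: eqP.
Qed.

Ltac s4_compute :=
  rewrite /tau1 /tau2 /tau /phi !permM !tperm_if;
  do ![rewrite !pt_inj //=].

Lemma phi_pt :
  [/\ phi (pt 1) = pt 2, phi (pt 2) = pt 3, phi (pt 3) = pt 1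
    & phi (pt 4) = pt 4].
Proof. by split; s4_compute. Qed.

Ltac s4_tac := apply/permP; elim/ptP; s4_compute.

Lemma tau1_phi : (tau1 * phi = phi * tau2)%g.
Proof. s4_tac. Qed.
Lemma tau2_phi : (tau2 * phi = phi * (tau2 * tau1))%g.
Proof. s4_tac. Qed.
Lemma tau_tau1 : (tau * tau1 = tau1 * tau)%g.
Proof. s4_tac. Qed.
Lemma tau_tau : (tau * tau = 1)%g.
Proof. exact: tperm2. Qed.
Lemma tau_tau2 : (tau * tau2 = tau1 * tau2 * tau)%g.
Proof. s4_tac. Qed.
Lemma phi_tau : (phi * tau = tau * (phi * phi))%g.
Proof. s4_tac. Qed.
Lemma phi_tau1 : (phi * tau1 = tau2 * tau1 * phi)%g.
Proof. s4_tac. Qed.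

Lemma phi3 : (phi * phi * phi = 1)%g.
Proof. by apply/permP; elim/ptP; rewrite [in RHS]perm1; s4_compute. Qed.

Section S4Action.
Variables (F : fieldType) (g : lieAlgType F) (f : s4_action g).
Implicit Types x y : g.

Lemma s4_act1 : f 1%g =1 id.
Proof.
move=> x; apply: (bij_inj (lie_aut_bij (f 1%g))).
by rewrite -[RHS](congr1 (fun s => f s x) (mul1g 1%g)) s4_actM.
Qed.

Lemma s4_actK s : cancel (f s) (f s^-1%g).
Proof. by move=> x; have /= <- := s4_actM f s s^-1%g x; rewrite mulgV s4_act1. Qed.

Lemma s4_actKV s : cancel (f s^-1%g) (f s).
Proof. by move=> x; have /= <- := s4_actM f s^-1%g s x; rewrite mulVg s4_act1. Qed.

Lemma s4_act_comp s u x : f (s * u)%g x = f u (f s x).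
Proof. exact: s4_actM. Qed.

Lemma act_tau1_phi x : f tau1 (f phi x) = f phi (f tau1 (f tau2 x)).
Proof.
by rewrite -s4_act_comp phi_tau1 (s4_act_comp (tau2 * tau1)) (s4_act_comp tau2).
Qed.

Lemma act_tau2_phi x : f tau2 (f phi x) = f phi (f tau1 x).
Proof. by rewrite -s4_act_comp -tau1_phi (s4_act_comp tau1). Qed.

Lemma act_tau1_tau x : f tau1 (f tau x) = f tau (f tau1 x).
Proof. by rewrite -s4_act_comp tau_tau1 (s4_act_comp tau1). Qed.

Lemma act_tau2_tau x : f tau2 (f tau x) = f tau (f tau2 (f tau1 x)).
Proof.
by rewrite -s4_act_comp tau_tau2 (s4_act_comp (tau1 * tau2)) (s4_act_comp tau1).
Qed.

Definition in_t : {pred g} := fun x => (f tau1 x == x) && (f tau2 x == x).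
Definition in_g0 : {pred g} := fun x => (f tau1 x == x) && (f tau2 x == - x).

Lemma in_tP x : reflect (f tau1 x = x /\ f tau2 x = x) (x \in in_t).
Proof. by apply: (iffP andP) => -[/eqP ? /eqP ?]. Qed.

Lemma in_g0P x : reflect (f tau1 x = x /\ f tau2 x = - x) (x \in in_g0).
Proof. by apply: (iffP andP) => -[/eqP ? /eqP ?]. Qed.

Lemma in_t_submod : submod_closed in_t.
Proof.
split=> [|a x y /in_tP[x1 x2] /in_tP[y1 y2]]; apply/in_tP.
  by rewrite !linear0.
by rewrite !linearP x1 x2 y1 y2.
Qed.

Lemma in_g0_submod : submod_closed in_g0.
Proof.
split=> [|a x y /in_g0P[x1 x2] /in_g0P[y1 y2]]; apply/in_g0P.
  by rewrite !linear0.
by rewrite !linearP x1 x2 y1 y2.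
Qed.

HB.instance Definition _ := GRing.isSubmodClosed.Build F g in_t in_t_submod.
HB.instance Definition _ := GRing.isSubmodClosed.Build F g in_g0 in_g0_submod.

Record algA := AlgA { A_val :> g; A_valP : A_val \in in_g0 }.
HB.instance Definition _ := [isSub for A_val].
HB.instance Definition _ := [Choice of algA by <:].
HB.instance Definition _ := [SubChoice_isSubLmodule of algA by <:].

Record lieT := LieT { t_val :> g; t_valP : t_val \in in_t }.
HB.instance Definition _ := [isSub for t_val].
HB.instance Definition _ := [Choice of lieT by <:].
HB.instance Definition _ := [SubChoice_isSubLmodule of lieT by <:].

(* g may be infinite dimensional, so 'End(algA) is not available; elements of
   gl are compared pointwise, by =1. *)
Definition gl := {linear algA -> algA}.

Definition iotaA (i : 'Z_3) (x : algA) : g := f (phi ^+ i)%g (A_val x).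

Lemma in_t_phiX n (d : g) : d \in in_t -> f (phi ^+ n)%g d \in in_t.
Proof.
elim: n d => [|n IH] d dt; first by rewrite expg0 s4_act1.
rewrite expgS s4_act_comp; apply: IH.
have [d1 d2] := in_tP _ dt.
by apply/in_tP; rewrite !act_tau1_phi !act_tau2_phi d2 d1.
Qed.

Lemma in_t_phiV n (d : g) : d \in in_t -> f (phi ^- n)%g d \in in_t.
Proof.
have -> : (phi ^- n = phi ^+ (2 * n))%g.
  apply/eqP; rewrite eq_invg_mul -expgD -[X in (X + _)%N]mul1n -mulnDl expgM.
  by rewrite !expgS expg0 mulg1 mulgA phi3 expg1n.
exact: in_t_phiX.
Qed.

Lemma in_t_g0_g0 (d x : g) : d \in in_t -> x \in in_g0 -> [lie d, x] \in in_g0.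
Proof.
move=> /in_tP[d1 d2] /in_g0P[x1 x2]; apply/in_g0P.
by rewrite !lie_aut_lie d1 d2 x1 x2 linearNr.
Qed.

Lemma in_g0_g0_t (x y : g) : x \in in_g0 -> y \in in_g0 -> [lie x, y] \in in_t.
Proof.
move=> /in_g0P[x1 x2] /in_g0P[y1 y2]; apply/in_tP.
by rewrite !lie_aut_lie x1 x2 y1 y2 linearNr linearNl opprK.
Qed.

Lemma in_g0_star (x y : algA) : [lie iotaA 1 x, iotaA 2 y] \in in_g0.
Proof.
have [/in_g0P[x1 x2] /in_g0P[y1 y2]] := (A_valP x, A_valP y).
apply/in_g0P; rewrite !lie_aut_lie /iotaA expg1 expgS expg1 (s4_act_comp phi phi).
rewrite !(act_tau1_phi, act_tau2_phi) x2 y2 x1 y1 !linearN /= x1 y1.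
rewrite linearNl linearNr /=; split; last by [].
by rewrite y2 !linearN /= y1 linearNr opprK.
Qed.

(* Characterized by iotaA_star below, at i = 1. *)
Definition star (x y : algA) : algA := AlgA (in_g0_star x y).

Lemma in_g0_bar (x : algA) : - f tau (A_val x) \in in_g0.
Proof.
have /in_g0P[x1 x2] := A_valP x.
apply/in_g0P; rewrite !linearN /= act_tau1_tau act_tau2_tau x1 x2.
by rewrite linearN.
Qed.

(* Characterized by tau_iotaA0 below. *)
Definition bar (x : algA) : algA := AlgA (in_g0_bar x).

Definition dotA (x y : algA) : algA := bar (star x y).

Lemma in_g0_rho (i : 'Z_3) (d : lieT) (x : algA) :
  f (phi ^- i)%g [lie t_val d, iotaA i x] \in in_g0.
Proof.
rewrite lie_aut_lie /iotaA s4_actK in_t_g0_g0 ?in_t_phiV ?t_valP ?A_valP //.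
Qed.

(* The unique endomorphism satisfying iotaA_rho below. *)
Definition rho (i : 'Z_3) (d : lieT) (x : algA) : algA := AlgA (in_g0_rho i d x).

Lemma iotaAD (i j : 'Z_3) (x : algA) :
  iotaA (i + j) x = f (phi ^+ i)%g (iotaA j x).
Proof.
have p3 : (phi ^+ 3 = 1)%g by rewrite !expgS expg0 mulg1 mulgA phi3.
by rewrite /iotaA -s4_act_comp -expgD -(expg_mod (j + i) p3) addnC.
Qed.

Lemma iotaA_star (i : 'Z_3) (x y : algA) :
  [lie iotaA i x, iotaA (i + 1) y] = iotaA (i + 2) (star x y).
Proof.
have z3 : 2 + 1 = 0 :> 'Z_3 by exact: val_inj.
have -> : i = i + 2 + 1 by rewrite -addrA z3 addr0.
move: (i + 2) => k; have -> : k + 1 + 1 = k + 2 by rewrite -addrA.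
have -> : k + 1 + 2 = k by rewrite -addrA (addrC 1) z3 addr0.
by rewrite (iotaAD k 1) (iotaAD k 2) -lie_aut_lie.
Qed.

Lemma iotaA_rho (i : 'Z_3) (d : lieT) (x : algA) :
  iotaA i (rho i d x) = [lie t_val d, iotaA i x].
Proof. by rewrite /iotaA s4_actKV. Qed.

Lemma tau_iotaA0 (x : algA) : f tau (iotaA 0 x) = - iotaA 0 (bar x).
Proof. by rewrite /iotaA expg0 !s4_act1 opprK. Qed.

Lemma barK : involutive bar.
Proof.
move=> x; apply: val_inj; rewrite /= linearN opprK -s4_act_comp tau_tau.
exact: s4_act1.
Qed.

Lemma bar_star (x y : algA) : bar (star x y) = star (bar y) (bar x).
Proof.
have tauphi z : f tau (f phi z) = f phi (f phi (f tau z)).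
  by rewrite -s4_act_comp phi_tau (s4_act_comp tau) (s4_act_comp phi).
have phi3E z : f phi (f phi (f phi z)) = z.
  by rewrite -(s4_act_comp phi phi) -(s4_act_comp phi (phi * phi)) mulgA phi3 s4_act1.
apply: val_inj; rewrite /= lie_aut_lie /iotaA expg1 expgS expg1.
rewrite !(s4_act_comp phi phi) !tauphi phi3E /= lie_anti opprK.
by rewrite !linearN linearNl linearNr opprK.
Qed.

Lemma star_bilinear : bilinear_for *:%R *:%R star.
Proof.
split=> u a x y; apply: val_inj; rewrite /= /iotaA /= linearP.
  by rewrite linearPl.
by rewrite linearPr.
Qed.
HB.instance Definition _ :=
  bilinear_isBilinear.Build F algA algA algA _ _ star star_bilinear.

Lemma bar_linear : linear bar.
Proof. by move=> a x y; apply: val_inj; rewrite /= !linearP. Qed.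
HB.instance Definition _ := GRing.isLinear.Build F algA algA _ bar bar_linear.

Lemma dotA_bilinear : bilinear_for *:%R *:%R dotA.
Proof. by split=> u a x y; rewrite /dotA ?linearPl ?linearPr linearP. Qed.
HB.instance Definition _ :=
  bilinear_isBilinear.Build F algA algA algA _ _ dotA dotA_bilinear.

Lemma rho_linear i d : linear (rho i d).
Proof.
by move=> a x y; apply: val_inj; rewrite /= /iotaA /= linearP linearPr linearP.
Qed.
HB.instance Definition _ i d :=
  GRing.isLinear.Build F algA algA _ (rho i d) (rho_linear i d).

Definition glbar (d : gl) : gl := bar \o d \o bar.

Definition xi (d : gl * gl * gl) : gl * gl * gl :=
  let: (d0, d1, d2) := d in (glbar d0, glbar d2, glbar d1).

Definition glcomm (d e : gl) : gl := (d \o e) \- (e \o d).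

Lemma iotaA0 (x : algA) : iotaA 0 x = A_val x.
Proof. by rewrite /iotaA expg0 s4_act1. Qed.

Lemma in_t_iotaA0 (x y : algA) : [lie iotaA 0 x, iotaA 0 y] \in in_t.
Proof. by rewrite !iotaA0 in_g0_g0_t ?A_valP. Qed.

Definition delta (i : 'Z_3) (x y : algA) : gl :=
  rho i (LieT (in_t_iotaA0 x y)).

Definition delta3 (x y : algA) : gl * gl * gl :=
  (delta 0 x y, delta 1 x y, delta 2 x y).

Definition ldotA (x z : algA) : algA := dotA x z.
Definition rdotA (x z : algA) : algA := dotA z x.

Lemma ldotA_linear (x : algA) : linear (ldotA x).
Proof. by move=> a y z; rewrite /ldotA linearPr. Qed.
HB.instance Definition _ (x : algA) :=
  GRing.isLinear.Build F algA algA _ (ldotA x) (ldotA_linear x).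

Lemma rdotA_linear (x : algA) : linear (rdotA x).
Proof. by move=> a y z; rewrite /rdotA linearPl. Qed.
HB.instance Definition _ (x : algA) :=
  GRing.isLinear.Build F algA algA _ (rdotA x) (rdotA_linear x).

End S4Action.

(* Main.v *)
Require Import Defs.
From mathcomp Require Import all_boot all_order all_algebra all_fingroup.
From HB Require Import structures.
Import GRing.Theory.
Local Open Scope ring_scope.

(** Since [iotaA i x] is [phi ^ i] applied to [x], the endomorphism
    [delta i x y] of [A] is [ad] of the element [phi ^ (- i) [x, y]] of [t].
    Everything then follows from the Jacobi identity: (i) says that
    [phi ^ (j - i) [a, b]] acts on [[x, y]] as a derivation, (ii) is the Jacobi
    identity for one element from each [g_k], (iii) the one for three elements
    of [g_0], (iv) and (v) the ones for two elements of [g_0] and one of [g_1],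
    respectively [g_2], and (vi) holds because [tau] inverts [phi]. *)

Section LieIdentities.
Variables (F : fieldType) (g : lieAlgType F).
Implicit Types a b c : g.

Lemma lie_derivation a b c :
  [lie a, [lie b, c]] = [lie [lie a, b], c] + [lie b, [lie a, c]].
Proof.
have /eqP := lie_jacobi a b c.
rewrite -addrA addr_eq0 => /eqP->.
by rewrite (lie_anti c a) (lie_anti c) linearNr opprD opprK opprK addrC.
Qed.

Lemma lie_lie a b c :
  [lie [lie a, b], c] = [lie a, [lie b, c]] - [lie b, [lie a, c]].
Proof. by rewrite lie_derivation addrK. Qed.

End LieIdentities.

Lemma Z3_add11 : 1 + 1 = - 1 :> 'Z_3.
Proof. exact: val_inj. Qed.

Lemma Z3_subN11 : - 1 - 1 = 1 :> 'Z_3.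
Proof. exact: val_inj. Qed.

Section Delta.
Variables (F : fieldType) (g : lieAlgType F) (f : s4_action g).
Implicit Types (i j : 'Z_3) (u v : g) (x y z : algA f).

(** Extends [iotaA] from [A] to all of [g], so that [phi] can be moved through brackets that leave
    [g_0]. *)
Definition rot i u : g := f (phi ^+ i)%g u.

Lemma rotD i j u : rot (i + j) u = rot i (rot j u).
Proof.
have p3 : (phi ^+ 3 = 1)%g by rewrite !expgS expg0 mulg1 mulgA phi3.
by rewrite /rot -s4_act_comp -expgD -(expg_mod (j + i) p3) addnC.
Qed.

Lemma rot0 u : rot 0 u = u.
Proof. by rewrite /rot expg0 s4_act1. Qed.

Lemma rotN i u : f (phi ^- i)%g u = rot (- i) u.
Proof. by rewrite -{1}[u]rot0 -(subrr i) rotD /rot s4_actK. Qed.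

Lemma rot_lie i u v : rot i [lie u, v] = [lie rot i u, rot i v].
Proof. exact: lie_aut_lie. Qed.

Lemma tau_rot i u : f tau (rot i u) = rot (- i) (f tau u).
Proof.
have tau_phi v : f tau (rot 1 v) = rot (- 1) (f tau v).
  by rewrite -Z3_add11 rotD /rot -s4_act_comp phi_tau (s4_act_comp _ tau) s4_act_comp.
(* Every element of ['Z_3] is the image of a natural number, which allows induction. *)
have tau_phiX n v : f tau (rot n%:R v) = rot (- n%:R) (f tau v).
  elim: n v => [|n IH] v; first by rewrite oppr0 !rot0.
  by rewrite -natr1 rotD IH tau_phi -rotD opprD.
by rewrite -[i]natr_Zp tau_phiX.
Qed.

Lemma rot_linear i : linear (rot i).
Proof. by move=> c u v; rewrite /rot linearP. Qed.
HB.instance Definition _ i := GRing.isLinear.Build F g g _ (rot i) (rot_linear i).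

Lemma valD x y : val (x + y) = val x + val y.
Proof. by []. Qed.

Lemma valB x y : val (x - y) = val x - val y.
Proof. by []. Qed.

(** The inverse twist by [phi ^- i] falls on both factors of the bracket and cancels the one that
    [iotaA i] puts on [z]. *)
Lemma val_delta i x y z :
  val (delta i x y z) = [lie rot (- i) [lie val x, val y], val z].
Proof.
by rewrite /= lie_aut_lie rotN !iotaA0 /iotaA s4_actK.
Qed.

Lemma val_bar x : val (bar x) = - f tau (val x).
Proof. by []. Qed.

Lemma val_star x y : val (star x y) = [lie rot 1 (val x), rot (- 1) (val y)].
Proof.
by rewrite /= /iotaA; congr [lie _, f (phi ^+ _)%g _].
Qed.

Lemma dotAE x y : dotA x y = star (bar y) (bar x).
Proof. exact: bar_star. Qed.

Lemma delta_comm i j a b x y :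
  glcomm (delta i a b) (delta j x y)
    =1 delta j (delta (i - j) a b x) y \+ delta j x (delta (i - j) a b y).
Proof.
move=> w; apply: val_inj.
change (val (delta i a b (delta j x y w) - delta j x y (delta i a b w)) =
  val (delta j (delta (i - j) a b x) y w + delta j x (delta (i - j) a b y) w)).
rewrite valB valD !val_delta -lie_lie -linearDl /= -linearD /=.
(* What remains is an identity in [g]: [rot (- j)] of the derivation rule for [[x, y]], with
   exponents [- j - (i - j) = - i]. *)
congr lie; rewrite -lie_derivation [RHS]rot_lie -rotD.
by rewrite opprB addrA addNr add0r.
Qed.

Lemma delta_cycle x y z :
  delta 0 (bar x) (dotA y z) \+ delta 1 (bar y) (dotA z x)
    \+ delta 2 (bar z) (dotA x y) =1 \0.
Proof.
move=> w; apply: val_inj.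
change (val (delta 0 (bar x) (dotA y z) w + delta 1 (bar y) (dotA z x) w
  + delta 2 (bar z) (dotA x y) w) = 0).
rewrite !valD !val_delta !dotAE !val_star (Z3_add11 : 2 = - 1) opprK oppr0 rot0.
rewrite -!linearDl /= !rot_lie -!rotD Z3_subN11 Z3_add11 subrr addNr !rot0.
(* The sum is the Jacobi identity for [bar x], [rot 1 (bar z)] and [rot (- 1) (bar y)]. *)
by rewrite addrAC lie_jacobi linear0l.
Qed.

Lemma delta0_cycle x y z :
  delta 0 x y z + delta 0 y z x + delta 0 z x y = 0.
Proof.
apply: val_inj; rewrite !valD !val_delta oppr0 !rot0.
rewrite ![in LHS](lie_anti [lie _, _]) -!opprD.
by rewrite addrC addrA lie_jacobi oppr0.
Qed.

Lemma delta1E x y :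
  delta 1 x y =1 (ldotA (bar y) \o ldotA x) \- (ldotA (bar x) \o ldotA y).
Proof.
move=> z; apply: val_inj.
change (val (delta 1 x y z) =
  val (dotA (bar y) (dotA x z) - dotA (bar x) (dotA y z))).
(* Expanding the outer product by [dotAE] and the inner one by definition cancels all bars:
   [L_(bar y) L_x z] is [star (star x z) y]. *)
rewrite valB !(dotAE (bar _)) /dotA !barK !val_star val_delta.
rewrite !rot_lie -!rotD Z3_add11 subrr !rot0 lie_lie addrC.
by rewrite (lie_anti _ (rot (- 1) (val y))) (lie_anti _ (rot (- 1) (val x))) opprK.
Qed.

Lemma delta2E x y :
  delta 2 x y =1 (rdotA (bar y) \o rdotA x) \- (rdotA (bar x) \o rdotA y).
Proof.
move=> z; apply: val_inj.
change (val (delta 2 x y z) =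
  val (dotA (dotA z x) (bar y) - dotA (dotA z y) (bar x))).
(* Likewise [R_(bar y) R_x z] is [star y (star z x)]. *)
rewrite valB !(dotAE _ (bar _)) /dotA !barK !val_star val_delta.
rewrite (Z3_add11 : 2 = - 1) opprK !rot_lie -!rotD Z3_subN11 addNr !rot0 lie_lie.
by rewrite !(lie_anti (val z)) !linearNr opprK addrC.
Qed.

Lemma glbar_delta i x y : glbar (delta i x y) =1 delta (- i) (bar x) (bar y).
Proof.
move=> z; apply: val_inj.
change (val (bar (delta i x y (bar z))) = val (delta (- i) (bar x) (bar y) z)).
rewrite val_bar !val_delta !val_bar.
rewrite lie_aut_lie tau_rot lie_aut_lie.
(* The signs carried by the four bars cancel in pairs. *)
by rewrite !linearN -s4_act_comp tau_tau s4_act1 linearNl !linearNr !opprK.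
Qed.

End Delta.

Theorem theorem2p4 (F : fieldType) (charF : 2%N \notin [pchar F])
  (g : lieAlgType F) (f : s4_action g) (a b x y z : algA f) (i j : 'Z_3) :
  [/\ glcomm (delta i a b) (delta j x y)
        =1 delta j (delta (i - j) a b x) y \+ delta j x (delta (i - j) a b y),
      delta 0 (bar x) (dotA y z) \+ delta 1 (bar y) (dotA z x)
        \+ delta 2 (bar z) (dotA x y) =1 \0,
      delta 0 x y z + delta 0 y z x + delta 0 z x y = 0
    & [/\ delta 1 x y =1 (ldotA (bar y) \o ldotA x) \- (ldotA (bar x) \o ldotA y),
          delta 2 x y =1 (rdotA (bar y) \o rdotA x) \- (rdotA (bar x) \o rdotA y),
          glbar (delta i x y) =1 delta (- i) (bar x) (bar y)
        & let: (d0, d1, d2) := xi (delta3 x y) in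
          let: (e0, e1, e2) := delta3 (bar x) (bar y) in
          [/\ d0 =1 e0, d1 =1 e1 & d2 =1 e2]]].
Proof.
split; [exact: delta_comm | exact: delta_cycle | exact: delta0_cycle | split].
- exact: delta1E.
- exact: delta2E.
- exact: glbar_delta.
(* The swap of the last two components in [xi] is negation of the index, since [2 = - 1] in
   ['Z_3]. *)
by split=> w; rewrite glbar_delta ?(Z3_add11 : 2 = - 1) ?opprK ?oppr0.
Qed.
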